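(* Let $\alpha,\beta$ be types. For every $a:\alpha$ and every function $f:\alpha\to \mathrm{unit}+(\mathcal{P}(\mathrm{Node}_\beta)\times\alpha)$, the corecursion operator $\mathrm{LList\_corec}$ satisfies $$\mathrm{LList\_corec}\,a\,f=\begin{cases}\mathrm{NIL} & \text{if } f\,a=\mathrm{Inl}\,(),\\ \mathrm{CONS}\,x\,(\mathrm{LList\_corec}\,b\,f) & \text{if } f\,a=\mathrm{Inr}\,(x,b).\end{cases}$$
   Context: Setting: classical higher-order logic (total functions). $\mathbb{N}$ denotes the natural numbers including $0$; $\mathrm{unit}$ is the one-element type with sole value $()$; $\sigma+\tau$ is the disjoint sum type with injections $\mathrm{Inl},\mathrm{Inr}$. Nodes and trees: for a type $\beta$, $\mathrm{Node}_\beta$ is the type of pairs $(g,y)$ with $g:\mathbb{N}\to\mathbb{N}$, $y:\beta+\mathbb{N}$, such that $g\,n=0$ for some $n$. A construction (tree) is an arbitrary set of nodes, i.e. an element of $\mathcal{P}(\mathrm{Node}_\beta)$. For $k\in\mathbb{N}$ and $g:\mathbb{N}\to\mathbb{N}$, $\mathrm{Push}\,k\,g:\mathbb{N}\to\mathbb{N}$ is given by $(\mathrm{Push}\,k\,g)(0)=k+1$ and $(\mathrm{Push}\,k\,g)(j+1)=g(j)$. Define $M\cdot N=\{(\mathrm{Push}\,0\,g,y)\mid (g,y)\in M\}\cup\{(\mathrm{Push}\,1\,g,y)\mid (g,y)\in N\}$, $\mathrm{Numb}\,k=\{(\lambda i.0,\ \mathrm{Inr}\,k)\}$, $\mathrm{In0}\,M=\mathrm{Numb}\,0\cdot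 M$, $\mathrm{In1}\,N=\mathrm{Numb}\,1\cdot N$, $\mathrm{NIL}=\mathrm{In0}(\mathrm{Numb}\,0)$, $\mathrm{CONS}\,M\,N=\mathrm{In1}(M\cdot N)$. Corecursion: define $\mathrm{lcorf}$ by primitive recursion on $k\in\mathbb{N}$: $\mathrm{lcorf}\,0\,a\,f=\emptyset$, and $\mathrm{lcorf}\,(k+1)\,a\,f$ equals $\mathrm{NIL}$ if $f\,a=\mathrm{Inl}\,()$ and equals $\mathrm{CONS}\,x\,(\mathrm{lcorf}\,k\,b\,f)$ if $f\,a=\mathrm{Inr}\,(x,b)$. Then $\mathrm{LList\_corec}\,a\,f=\bigcup_{k\in\mathbb{N}}\mathrm{lcorf}\,k\,a\,f$. *)

(* Defs.v *)
From mathcomp Require Import all_boot.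
From mathcomp Require Import classical_sets.

Set Implicit Arguments.
Unset Strict Implicit.
Unset Printing Implicit Defensive.

Local Open Scope classical_set_scope.

Definition Node (beta : Type) : Type :=
  {p : (nat -> nat) * (beta + nat) | exists n, p.1 n = 0}.

Definition Push (k : nat) (g : nat -> nat) : nat -> nat :=
  fun i => if i is j.+1 then g j else k.+1.

Section Constructions.
Variable beta : Type.
Implicit Types (d : Node beta) (M N : set (Node beta)) (k : nat).

Lemma push_node_subproof k d : exists n, Push k (sval d).1 n = 0.
Proof. by case: d => -[g y] [n gn0]; exists n.+1. Qed.

Definition push_node k d : Node beta :=
  exist (fun p : (nat -> nat) * (beta + nat) => exists n, p.1 n = 0)
    (Push k (sval d).1, (sval d).2) (push_node_subproof k d).

(* The product of constructions usually written M . N *)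
Definition Scons M N : set (Node beta) :=
  [set push_node 0 d | d in M] `|` [set push_node 1 d | d in N].

Definition numb_node k : Node beta :=
  exist (fun p : (nat -> nat) * (beta + nat) => exists n, p.1 n = 0)
    (fun=> 0, inr k) (ex_intro _ 0 erefl).

Definition Numb k : set (Node beta) := [set numb_node k].

Definition In0 M := Scons (Numb 0) M.
Definition In1 N := Scons (Numb 1) N.

Definition NIL : set (Node beta) := In0 (Numb 0).
Definition CONS M N : set (Node beta) := In1 (Scons M N).

End Constructions.

Arguments Numb {beta} k.
Arguments NIL {beta}.

Section Corecursion.
Variables alpha beta : Type.

Fixpoint lcorf (k : nat) (a : alpha)
    (f : alpha -> unit + (set (Node beta) * alpha)) : set (Node beta) :=
  if k is k'.+1 then
    match f a with
    | inl tt => NIL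
    | inr (x, b) => CONS x (lcorf k' b f)
    end
  else set0.

Definition LList_corec (a : alpha)
    (f : alpha -> unit + (set (Node beta) * alpha)) : set (Node beta) :=
  \bigcup_k lcorf k a f.

End Corecursion.

(* Main.v *)
Require Import Defs.
From mathcomp Require Import all_boot.
From mathcomp Require Import classical_sets.

(* [Scons], hence [CONS x], commutes with unions over [nat] in its second
   argument (nonemptiness of the index set matters, as [Scons M set0] need not
   be empty); since [lcorf 0] is empty, the union defining [LList_corec] may be
   taken over successors only, where [lcorf] unfolds. *)

Local Open Scope classical_set_scope.

Lemma Scons_bigcupr (beta : Type) (M : set (Node beta))
    (F : nat -> set (Node beta)) :
  Scons M (\bigcup_k F k) = \bigcup_k Scons M (F k).
Proof.
rewrite /Scons image_bigcup; apply/seteqP; split=> d.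
(* A node coming from [M] lies in [Scons M (F k)] for every [k], so the index [0] is an arbitrary
   choice. *)
- by case=> [Md|[k _ Fd]]; [exists 0 => //; left | exists k => //; right].
- by case=> k _ [Md|Fd]; [left | right; exists k].
Qed.

(** The tail sits in the right factor of two nested products, [Scons (Numb 1) (Scons x _)], so the
    union is pulled out twice. *)
Lemma CONS_bigcupr (beta : Type) (x : set (Node beta))
    (F : nat -> set (Node beta)) :
  CONS x (\bigcup_k F k) = \bigcup_k CONS x (F k).
Proof. by rewrite /CONS /In1 !Scons_bigcupr. Qed.

Lemma LList_corec_bigcupS (alpha beta : Type) (a : alpha)
    (f : alpha -> unit + (set (Node beta) * alpha)) :
  LList_corec a f = \bigcup_k lcorf k.+1 a f.
Proof.
apply/seteqP; split=> d [].
- by case=> [|k] _ // fd; exists k.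
- by move=> k _ fd; exists k.+1.
Qed.

Theorem mainTheorem1 (alpha beta : Type) (a : alpha)
    (f : alpha -> unit + (set (Node beta) * alpha)) :
  LList_corec a f =
    match f a with
    | inl tt => NIL
    | inr (x, b) => CONS x (LList_corec b f)
    end.
Proof.
rewrite LList_corec_bigcupS /=; case: (f a) => [[]|[x b]].
(* Every approximation [lcorf k.+1] is now [NIL]; a constant union over a nonempty index set,
   witnessed by [0], is that constant. *)
- by apply: bigcup_const; exists 0.
- by rewrite -CONS_bigcupr.
Qed.
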